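(* Let $R=K[x_1,\dots,x_n]$ be graded by an abelian group $\mathsf A$ (a nice grading, see context), let $F_{-1}$ be a finitely generated graded free $R$-module with basis $\{[e]\}_{e\in E}$, let $M\subseteq F_{-1}$ be a graded submodule, let $<_0$ be a module ordering on $F_{-1}$ extending a monomial ordering $<$ on $R$, and let $\mathbf G$ be a finite homogeneous Gröbner basis of $(M,<_0)$. Let $$\cdots\to F_i\xrightarrow{\varphi_i}F_{i-1}\to\cdots\to F_0\xrightarrow{\varphi_0}M\to 0$$ be an output of Schreyer's algorithm (described in the context) on this input. If this output is a minimal graded free resolution of $M$, then $$\beta_{i,\mathsf j}(M)=\beta_{i,\mathsf j}(\mathrm{in}(M))\qquad\text{for all } i\ge 0 \text{ and all } \mathsf j\in\mathsf A,$$ where $\mathrm{in}(M)$ is the submodule of $F_{-1}$ generated by the leading monomials (with respect to $<_0$) of the elements of $M$.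
   Context: $K$ is a field. Gradings: every monomial of $R$ is homogeneous, with degree given by a semigroup homomorphism $\mathbb N^n\to\mathsf A$; the grading is assumed to be nice in the sense that Nakayama's lemma holds: with $\mathfrak m$ the maximal ideal spanned by the nonconstant monomials, every finitely generated $\mathsf A$-graded $R$-module $N$ with $\mathfrak mN=N$ is zero. Hence minimal graded free resolutions (those with $\varphi_{i+1}(F_{i+1})\subseteq\mathfrak mF_i$ for all $i\ge0$) and graded Betti numbers $\beta_{i,\mathsf j}$ (the number of degree-$\mathsf j$ basis elements of the $i$-th free module of a minimal graded free resolution) are well defined. A module ordering on a free module with basis symbols $[e]$ is a total ordering on the monomials $\mathbf x^\alpha[e]$ extending a monomial ordering of $R$ and compatible with the $R$-module structure. $\mathrm{LM}$ denotes leading monomial. All Gröbner basis elements are normalized to have leading coefficient $1$. One step of Schreyer's construction: let $\mathbf G'$ be a finite homogeneous Gröbner basis of a submodule of a free module $F'$ with module ordering $<'$, let $\prec$ be a total order on $\mathbf G'$, and let $F''$ be the free module on symbols $[g]$, $g\in\mathbf G'$, with $\deg[g]=\deg g$. The pulled back module ordering $<''$ on $F''$ is: $\mathbf x^\beta[h]<''\mathbf x^\alpha[f]$ iff $\mathrm{LM}(\mathbf x^\beta h)<'\mathrm{LM}(\mathbf x^\alpha f)$, or $\mathrm{LM}(\mathbf x^\beta h)=\mathrm{LM}(\mathbf x^\alpha f)$ and $f\prec h$. For $f\prec h$ in $\mathbf G'$ whose leading monomials $\mathbf x^{\alpha(f)}[e]$, $\mathbf x^{\alpha(h)}[e]$ involve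 the same basis element $[e]$ of $F'$, put $\gamma=\max(\alpha(f),\alpha(h))$ (entrywise), choose a standard representation $\mathbf x^{\gamma-\alpha(f)}f-\mathbf x^{\gamma-\alpha(h)}h=\sum_{g\in\mathbf G'}a_g g$ (homogeneous $a_g\in R$, with $\mathrm{LM}(a_g g)$ not exceeding the leading monomial of the left-hand side whenever $a_g\ne0$; all $a_g=0$ if the left-hand side is $0$), and set $s(f,h)=\mathbf x^{\gamma-\alpha(f)}[f]-\mathbf x^{\gamma-\alpha(h)}[h]-\sum_g a_g[g]\in F''$. The set $\mathcal S(\mathbf G')$ of all such $s(f,h)$ is a homogeneous Gröbner basis, with respect to $<''$, of the kernel of $F''\to F'$, $[g]\mapsto g$; one has $\mathrm{LM}(s(f,h))=\mathbf x^{\gamma-\alpha(f)}[f]$. Let $\mathcal S_{\min}(\mathbf G')\subseteq\mathcal S(\mathbf G')$ be a subset that is still a Gröbner basis of this kernel and in which no leading monomial divides the leading monomial of another element (a minimal Gröbner basis). Schreyer's algorithm: $\mathbf G_0=\mathbf G$; $F_0$ is free on $[g]$, $g\in\mathbf G_0$, and $\varphi_0:F_0\to M$, $[g]\mapsto g$. For $i\ge0$, while $F_i\neq0$: choose any total order $\prec_i$ on $\mathbf G_i$, let $<_{i+1}$ be the module ordering on $F_i$ pulled back from $<_i$ on $F_{i-1}$, let $\mathbf G_{i+1}=\mathcal S_{\min}(\mathbf G_i)\subset F_i$, let $F_{i+1}$ be free on $[u]$, $u\in\mathbf G_{i+1}$, with $\deg[u]=\deg u$, and let $\varphi_{i+1}:F_{i+1}\to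 F_i$, $[u]\mapsto u$. The output is always a graded free resolution of $M$, in general not minimal. *)

(* Defs.v *)
From Stdlib Require Import ClassicalEpsilon.
From HB Require Import structures.
From mathcomp Require Import all_boot all_order all_algebra.
From mathcomp Require Import mpoly.

Set Implicit Arguments.
Unset Strict Implicit.
Unset Printing Implicit Defensive.

Import GRing.Theory.

Local Open Scope ring_scope.

(* Conventions: R = {mpoly K[n]}; the free R-module of rank r is 'rV[R]_r, its
   basis symbols being indexed by 'I_r; a linear map between free modules is
   v |-> v *m B, so that the rows of B are the images of the basis symbols.
   Submodules and subsets are Prop-valued predicates, and all orders are the
   strict ones. *)

Definition strict_total (T : eqType) (lt : rel T) : Prop :=
  [/\ irreflexive lt, transitive lt
    & forall x y, x != y -> lt x y || lt y x].

(* The set of finite sums of products a *: w with a in I and w in S. *)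
Definition combinations (R : nzRingType) (N : lmodType R)
    (I : R -> Prop) (S : N -> Prop) (v : N) : Prop :=
  exists s : seq (R * N),
    (forall t, t \in s -> I t.1 /\ S t.2) /\ v = \sum_(t <- s) t.1 *: t.2.

Definition span (R : nzRingType) (N : lmodType R) (S : N -> Prop) : N -> Prop :=
  combinations (fun _ => True) S.

Definition finitely_generated (R : nzRingType) (N : lmodType R) : Prop :=
  exists s : seq N, forall v, span (fun w => w \in s) v.

Definition is_submodule (R : nzRingType) (N : lmodType R) (M : N -> Prop)
    : Prop :=
  [/\ M 0, forall v w, M v -> M w -> M (v + w) & forall a v, M v -> M (a *: v)].

Section Gradings.

Context (K : fieldType) (n : nat) (A : zmodType) (deg : 'X_{1..n} -> A).
Local Notation R := {mpoly K[n]}.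

(* For a group A, additivity forces the degree of the monomial 1 to be 0. *)
Definition monomial_grading : Prop :=
  {morph deg : a b / (a + b)%MM >-> a + b}.

(* The ideal spanned by the nonconstant monomials. *)
Definition max_ideal (p : R) : Prop := 0%MM \notin msupp p.

Definition max_ideal_mul (N : lmodType R) : N -> Prop :=
  combinations max_ideal (fun _ => True).

(* [H j] is the homogeneous part of degree j of the R-module N. *)
Definition module_grading (N : lmodType R) (H : A -> N -> Prop) : Prop :=
  [/\ forall j, H j 0 /\ (forall v w, H j v -> H j w -> H j (v + w)),
      forall j (c : K) m v, H j v -> H (deg m + j) ((c *: 'X_[m] : R) *: v),
      forall v, exists (s : seq A) (f : A -> N),
        (forall j, H j (f j)) /\ v = \sum_(j <- s) f j
    & forall (s : seq A) (f : A -> N), uniq s -> (forall j, H j (f j)) ->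
        \sum_(j <- s) f j = 0 -> forall j, j \in s -> f j = 0].

Definition nice_grading : Prop :=
  forall (N : lmodType R) (H : A -> N -> Prop),
    module_grading H -> finitely_generated N ->
    (forall v : N, max_ideal_mul v) -> forall v : N, v = 0.

Definition homogeneous r (bdeg : 'I_r -> A) (j : A) (v : 'rV[R]_r) : Prop :=
  forall k m, m \in msupp (v 0 k) -> deg m + bdeg k = j.

Definition homogeneous_component r (bdeg : 'I_r -> A) (j : A) (v : 'rV[R]_r)
    : 'rV[R]_r :=
  \row_k \sum_(m <- msupp (v 0 k) | deg m + bdeg k == j) (v 0 k)@_m *: 'X_[m].

Definition graded_submodule r (bdeg : 'I_r -> A) (M : 'rV[R]_r -> Prop)
    : Prop :=
  is_submodule M /\ forall j v, M v -> M (homogeneous_component bdeg j v).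

End Gradings.

Section Groebner.

Context (K : fieldType) (n : nat).
Local Notation R := {mpoly K[n]}.

(* (a, k) stands for the monomial x^a [k] of the free module of rank r. *)
Definition mmon (r : nat) : eqType := ('X_{1..n} * 'I_r)%type.

Definition mmon_vec r (u : mmon r) : 'rV[R]_r := 'X_[u.1] *: delta_mx 0 u.2.

Definition mmon_dvd r (u w : mmon r) : bool :=
  (u.2 == w.2) && (u.1 <= w.1)%MM.

Definition monomial_ordering (lt : rel 'X_{1..n}) : Prop :=
  [/\ strict_total lt,
      forall a b c, lt a b -> lt (c + a)%MM (c + b)%MM
    & forall a, a != 0%MM -> lt 0%MM a].

Definition module_ordering (lt : rel 'X_{1..n}) r (ltF : rel (mmon r)) : Prop :=
  [/\ strict_total ltF,
      forall a b k, lt a b -> ltF (a, k) (b, k)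
    & forall c (u w : mmon r),
        ltF u w -> ltF ((c + u.1)%MM, u.2) ((c + w.1)%MM, w.2)].

Definition vec_supp r (v : 'rV[R]_r) : seq (mmon r) :=
  [seq (m, k) | k <- enum 'I_r, m <- msupp (v 0 k)].

(* Leading monomial; [None] exactly for the zero vector, as soon as ltF is a
   strict total order. *)
Definition LM r (ltF : rel (mmon r)) (v : 'rV[R]_r) : option (mmon r) :=
  ohead [seq u <- vec_supp v
        | all (fun w => (w == u) || ltF w u) (vec_supp v)].

Definition LM_le r (ltF : rel (mmon r)) (v w : 'rV[R]_r) : Prop :=
  exists a b, [/\ LM ltF v = Some a, LM ltF w = Some b & (a == b) || ltF a b].

Definition monic r (ltF : rel (mmon r)) (v : 'rV[R]_r) : Prop :=
  exists2 u, LM ltF v = Some u & (v 0 u.2)@_(u.1) = 1.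

Definition initial_submodule r (ltF : rel (mmon r)) (M : 'rV[R]_r -> Prop)
    : 'rV[R]_r -> Prop :=
  span (fun w => exists v u, [/\ M v, LM ltF v = Some u & w = mmon_vec u]).

Definition groebner_basis r (ltF : rel (mmon r)) (M : 'rV[R]_r -> Prop)
    (G : seq 'rV[R]_r) : Prop :=
  [/\ forall g, g \in G -> M g,
      forall g, g \in G -> monic ltF g
    & forall v, initial_submodule ltF M v <->
        span (fun w => exists g u,
                [/\ g \in G, LM ltF g = Some u & w = mmon_vec u]) v].

Definition rows r s (B : 'M[R]_(s, r)) : seq 'rV[R]_r :=
  [seq row u B | u <- enum 'I_s].

(* The rows of B list the elements of the finite set G without repetition. *)
Definition enumerates r s (B : 'M[R]_(s, r)) (G : seq 'rV[R]_r) : Prop :=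
  injective (fun u => row u B) /\ rows B =i G.

Definition kernel r s (B : 'M[R]_(s, r)) (v : 'rV[R]_s) : Prop := v *m B = 0.

Definition pullback_ordering r (ltF : rel (mmon r)) s (B : 'M[R]_(s, r))
    (prec : rel 'I_s) : rel (mmon s) := fun u w =>
  match LM ltF ('X_[u.1] *: row u.2 B), LM ltF ('X_[w.1] *: row w.2 B) with
  | Some a, Some b => ltF a b || ((a == b) && prec w.2 u.2)
  | _, _ => false
  end.

(* In the definitions below the leading monomials of row f B and row h B are
   x^af [k] and x^ah [k]. *)

Definition spair r s (B : 'M[R]_(s, r)) (f h : 'I_s) (af ah : 'X_{1..n})
    : 'rV[R]_r :=
  'X_[mlcm af ah - af] *: row f B - 'X_[mlcm af ah - ah] *: row h B.

Definition syzygy s (f h : 'I_s) (af ah : 'X_{1..n}) (a : 'rV[R]_s)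
    : 'rV[R]_s :=
  'X_[mlcm af ah - af] *: delta_mx 0 f - 'X_[mlcm af ah - ah] *: delta_mx 0 h
  - a.

Context (A : zmodType) (deg : 'X_{1..n} -> A).

(* [a] is the row of coefficients of a standard representation; each product
   a_g g has the degree of the S-pair, which is that of x^(gamma - af) f. *)
Definition standard_representation r (ltF : rel (mmon r)) s
    (B : 'M[R]_(s, r)) (bdeg : 'I_s -> A)
    (f h : 'I_s) (af ah : 'X_{1..n}) (a : 'rV[R]_s) : Prop :=
  let p := spair B f h af ah in
  [/\ p = \sum_g a 0 g *: row g B,
      homogeneous deg bdeg (deg (mlcm af ah - af)%MM + bdeg f) a,
      forall g, a 0 g != 0 -> LM_le ltF (a 0 g *: row g B) p
    & p = 0 -> a = 0].

(* [a f h] is the standard representation chosen for the pair f, h. *)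
Definition schreyer_choice r (ltF : rel (mmon r)) s (B : 'M[R]_(s, r))
    (bdeg : 'I_s -> A) (prec : rel 'I_s) (a : 'I_s -> 'I_s -> 'rV[R]_s)
    : Prop :=
  forall f h k af ah, prec f h ->
    LM ltF (row f B) = Some (af, k) -> LM ltF (row h B) = Some (ah, k) ->
    standard_representation ltF B bdeg f h af ah (a f h).

Definition schreyer_syzygies r (ltF : rel (mmon r)) s (B : 'M[R]_(s, r))
    (prec : rel 'I_s) (a : 'I_s -> 'I_s -> 'rV[R]_s) (v : 'rV[R]_s) : Prop :=
  exists f h k af ah,
    [/\ prec f h, LM ltF (row f B) = Some (af, k),
        LM ltF (row h B) = Some (ah, k) & v = syzygy f h af ah (a f h)].

Definition LM_minimal r (ltF : rel (mmon r)) (G : seq 'rV[R]_r) : Prop :=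
  forall g h u w, g \in G -> h \in G -> g != h ->
    LM ltF g = Some u -> LM ltF h = Some w -> ~~ mmon_dvd u w.

(* The rows of C form a set S_min obtained from the rows of B. *)
Definition schreyer_step r (ltF : rel (mmon r)) s (B : 'M[R]_(s, r))
    (bdeg : 'I_s -> A) (prec : rel 'I_s) t (C : 'M[R]_(t, s)) : Prop :=
  let ltF' := pullback_ordering ltF B prec in
  exists a : 'I_s -> 'I_s -> 'rV[R]_s,
    [/\ schreyer_choice ltF B bdeg prec a,
        forall u, schreyer_syzygies ltF B prec a (row u C),
        groebner_basis ltF' (kernel B) (rows C),
        injective (fun u => row u C)
      & LM_minimal ltF' (rows C)].

End Groebner.

Section Resolutions.

Context (K : fieldType) (n : nat) (A : zmodType) (deg : 'X_{1..n} -> A).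
Local Notation R := {mpoly K[n]}.

(* [shifted_rank e rk i] is the rank of F_(i-1), where e is the rank of F_(-1)
   and rk i that of F_i. *)
Definition shifted_rank (e : nat) (rk : nat -> nat) (i : nat) : nat :=
  if i is i'.+1 then rk i' else e.

Definition shifted_bdeg (e : nat) (edeg : 'I_e -> A) (rk : nat -> nat)
    (bdeg : forall i, 'I_(rk i) -> A) (i : nat)
    : 'I_(shifted_rank e rk i) -> A :=
  match i with 0 => edeg | i'.+1 => bdeg i' end.
Arguments shifted_bdeg [e] edeg [rk] bdeg i.

(* A sequence ... -> F_1 -> F_0 -> F_(-1) of free modules of finite rank with
   F_(-1) of rank e; finite sequences are continued by zero modules.  Here
   bmap i is the matrix of F_i -> F_(i-1). *)
Record free_sequence (e : nat) := FreeSequence {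
  rk : nat -> nat;
  bdeg : forall i, 'I_(rk i) -> A;
  bmap : forall i, 'M[R]_(rk i, shifted_rank e rk i)
}.
Arguments rk [e] f i.
Arguments bdeg [e] f i.
Arguments bmap [e] f i.

Definition graded_maps e (edeg : 'I_e -> A) (F : free_sequence e) : Prop :=
  forall i u, homogeneous deg (shifted_bdeg edeg (bdeg F) i)
                (bdeg F i u) (row u (bmap F i)).

Definition graded_free_resolution e (edeg : 'I_e -> A) (M : 'rV[R]_e -> Prop)
    (F : free_sequence e) : Prop :=
  [/\ graded_maps edeg F,
      forall v, M v <-> exists w : 'rV[R]_(rk F 0), v = w *m bmap F 0
    & forall i (v : 'rV[R]_(rk F i)),
        kernel (bmap F i) v <->
        exists w : 'rV[R]_(rk F i.+1), v = w *m bmap F i.+1].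

Definition minimal_graded_free_resolution e (edeg : 'I_e -> A)
    (M : 'rV[R]_e -> Prop) (F : free_sequence e) : Prop :=
  graded_free_resolution edeg M F /\
  forall i (v : 'rV[R]_(rk F i.+1)), max_ideal_mul (v *m bmap F i.+1).

(* The value picked does not depend on the resolution, minimal graded free
   resolutions being unique up to isomorphism. *)
Definition graded_betti e (edeg : 'I_e -> A) (M : 'rV[R]_e -> Prop)
    (i : nat) (j : A) : nat :=
  epsilon (inhabits 0%N) (fun b =>
    exists2 F : free_sequence e,
      minimal_graded_free_resolution edeg M F
      & b = #|[set u : 'I_(rk F i) | bdeg F i u == j]|).

(* The ordering <_i on F_(i-1), pulled back i times. *)
Fixpoint schreyer_ordering e (lt0 : rel (mmon n e)) (F : free_sequence e)
    (prec : forall i, rel 'I_(rk F i)) (i : nat)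
    : rel (mmon n (shifted_rank e (rk F) i)) :=
  match i return rel (mmon n (shifted_rank e (rk F) i)) with
  | 0 => lt0
  | i'.+1 =>
      pullback_ordering (@schreyer_ordering e lt0 F prec i') (bmap F i')
        (prec i')
  end.
Arguments schreyer_ordering [e] lt0 [F] prec i.

(* The stopping rule needs no clause: if F_i = 0 there are no pairs left, so
   the step forces F_(i+1) = 0. *)
Definition schreyer_output e (edeg : 'I_e -> A) (lt0 : rel (mmon n e))
    (G : seq 'rV[R]_e) (F : free_sequence e) : Prop :=
  [/\ enumerates (bmap F 0) G,
      graded_maps edeg F
    & exists2 prec : forall i, rel 'I_(rk F i),
        forall i, strict_total (prec i)
        & forall i, schreyer_step deg (schreyer_ordering lt0 prec i)
                      (bmap F i) (bdeg F i) (prec i) (bmap F i.+1)].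

End Resolutions.

(* Main.v *)
(* The Schreyer resolution F of M is filtered. Give a monomial x^a [u] of F_i
   the weight obtained by applying "leading monomial of the image" repeatedly
   until F_(-1) is reached; the weight is a monomial of F_(-1), weakly
   monotone for the pulled back ordering, and every term of the image of [u]
   has weight at most that of [u]. Keeping only the terms of equal weight
   gives the associated graded complex. It resolves in(M): if v is killed by
   the truncated map, then the true image of v has smaller weight, so v can be
   corrected by terms of smaller weight to a true cycle, whose leading
   monomial is divisible by that of some element of the next Groebner basis.
   The entries of the truncated matrices consist of terms of the original
   ones, so minimality is inherited, and the basis degrees are unchanged. It
   remains that graded Betti numbers can be read off any minimal graded free
   resolution; this follows from the comparison homotopy, which vanishes
   modulo the maximal ideal by minimality, without any appeal to Nakayama's
   lemma. *)

From Stdlib Require Import Classical ClassicalEpsilon.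
Require Import Defs.
From mathcomp Require Import all_boot all_order all_algebra.
From mathcomp Require Import mpoly.

Set Implicit Arguments.
Unset Strict Implicit.
Unset Printing Implicit Defensive.

Import GRing.Theory.

Local Open Scope ring_scope.

(** * Dickson's lemma and well-foundedness of module orderings *)

Lemma nondecreasing_subsequence (f : nat -> nat) :
  exists2 s : nat -> nat, {homo s : i j / (i < j)%N}
    & forall i j, (i < j)%N -> (f (s i) <= f (s j))%N.
Proof.
have later_min i :
    exists j, (i <= j)%N /\ forall k, (i <= k)%N -> (f j <= f k)%N.
  have [b [j ij fj]] : exists b, exists2 j, (i <= j)%N & f j = b.
    by exists (f i), i.
  elim/ltn_ind: b j ij fj => b IHb j ij fj.
  have [[k [ik fk]]|nk] := classic (exists k, (i <= k)%N /\ (f k < b)%N).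
    exact: IHb fk k ik erefl.
  exists j; split=> // k ik; rewrite leqNgt fj.
  by apply/negP=> fk; apply: nk; exists k.
pose g i := proj1_sig (constructive_indefinite_description _ (later_min i)).
have gP i : (i <= g i)%N /\ forall k, (i <= k)%N -> (f (g i) <= f k)%N.
  exact: proj2_sig (constructive_indefinite_description _ (later_min i)).
(* Each new index minimizes [f] on the whole tail after the previous one, so later values cannot be
   smaller. *)
pose s := fix s i := if i is i'.+1 then g (s i').+1 else g 0%N.
have s_step i : (s i < s i.+1)%N by have [] := gP (s i).+1.
exists s; first exact: homo_ltn ltn_trans s_step.
apply: homo_ltn leq_trans _ => -[|i] /=.
- by have [_ ->] := gP 0%N.
- by have [_ ->] := gP (s i).+1 => //; apply: leq_trans (s_step i.+1);
  apply/ltnW/s_step.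
Qed.

Lemma common_nondecreasing_subsequence (fs : seq (nat -> nat)) :
  exists2 s : nat -> nat, {homo s : i j / (i < j)%N}
    & forall k, (k < size fs)%N ->
        forall i j, (i < j)%N -> (nth id fs k (s i) <= nth id fs k (s j))%N.
Proof.
elim: fs => [|f fs [s s_mono fs_mono]]; first by exists id.
have [s' s'_mono f_mono] := nondecreasing_subsequence (f \o s).
exists (s \o s') => [i j ij|[|k] lt_k i j ij]; first exact/s_mono/s'_mono.
  exact: f_mono.
by apply: fs_mono => //; apply: s'_mono.
Qed.

Lemma dickson n r (u : nat -> mmon n r) :
  exists i j, [/\ (i < j)%N, (u i).2 = (u j).2 & ((u i).1 <= (u j).1)%MM].
Proof.
(* The position and its complement in [r] both being nondecreasing freezes the position; the
   truncated subtraction is harmless, positions being below [r]. The other functions are the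
   exponents. *)
pose fs := [:: (fun i => (u i).2 : nat), (fun i => (r - (u i).2)%N)
             & [seq (fun i => (u i).1 k) | k <- enum 'I_n]].
have [s s_mono fs_mono] := common_nondecreasing_subsequence fs.
have size_fs : size fs = n.+2 by rewrite /= size_map size_enum_ord.
exists (s 0%N), (s 1%N); split; first exact: s_mono.
- apply: val_inj; apply/eqP; rewrite eqn_leq.
  rewrite (fs_mono 0%N) //=.
  by have := fs_mono 1%N; rewrite size_fs /= => /(_ isT 0%N 1%N isT);
    rewrite leq_sub2lE // ltnW.
- apply/mnm_lepP => k; have := fs_mono k.+2.
  rewrite size_fs !ltnS ltn_ord => /(_ isT 0%N 1%N isT).
  by rewrite /= (nth_map k) ?size_enum_ord // nth_ord_enum.
Qed.

(** By [dickson], an infinite descending chain would contain a later term that is a multiple of an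
    earlier one, whereas multiples are never smaller. *)
Lemma module_ordering_wf n r (lt : rel 'X_{1..n}) (ltF : rel (mmon n r)) :
  monomial_ordering lt -> module_ordering lt ltF -> well_founded ltF.
Proof.
move=> [_ ltD lt0] [[ltFxx ltFt _] ltF_ext _] u0; apply: NNPP => u0_nacc.
have next (u : {u | ~ Acc ltF u}) :
    exists w : {u | ~ Acc ltF u}, ltF (sval w) (sval u).
  case: u => u u_nacc /=; apply: NNPP => no_next; apply: u_nacc.
  constructor=> w wu; apply: NNPP => w_nacc; apply: no_next.
  by exists (exist _ w w_nacc).
pose g u := proj1_sig (constructive_indefinite_description _ (next u)).
have gP u : ltF (sval (g u)) (sval u).
  exact: proj2_sig (constructive_indefinite_description _ (next u)).
pose c i := sval (iter i g (exist _ u0 u0_nacc)).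
have c_decr i j : (i < j)%N -> ltF (c j) (c i).
  apply: (@homo_ltn _ c (fun x y => ltF y x)) => [y x z xy yz|k];
    last exact: gP.
  exact: ltFt yz xy.
have [i [j [ij ck cm]]] := dickson c.
have := c_decr i j ij; apply/negP.
move: ck cm; case: (c i) (c j) => [a k] [b l] /= <- {l} ab.
have [->|neq_ab] := eqVneq a b; first by rewrite ltFxx.
apply/negP=> ltba; have ltab : ltF (a, k) (b, k).
  apply: ltF_ext; rewrite -(submK ab) -[X in lt X _]add0m addmC.
  rewrite [X in lt _ X]addmC; apply/ltD/lt0; apply: contra neq_ab => /eqP ba0.
  by rewrite -(submK ab) ba0 add0m.
by have := ltFt _ _ _ ltab ltba; rewrite ltFxx.
Qed.

(** * Coefficients of vectors at module monomials *)

Section Coefficients.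

Context (K : fieldType) (n : nat).
Local Notation R := {mpoly K[n]}.

Definition vcoef r (v : 'rV[R]_r) (u : mmon n r) : K := (v 0 u.2)@_(u.1).

Definition mshift r (a : 'X_{1..n}) (u : mmon n r) : mmon n r :=
  ((a + u.1)%MM, u.2).

Lemma mshiftA r a b (u : mmon n r) :
  mshift a (mshift b u) = mshift (a + b)%MM u.
Proof. by rewrite /mshift /= addmA. Qed.

Lemma vcoef_inj r (v w : 'rV[R]_r) : vcoef v =1 vcoef w -> v = w.
Proof. by move=> vw; apply/rowP=> k; apply/mpolyP=> m; apply: (vw (m, k)). Qed.

Lemma vcoef0 r u : vcoef (0 : 'rV[R]_r) u = 0.
Proof. by rewrite /vcoef mxE mcoeff0. Qed.

Lemma vcoefD r (v w : 'rV[R]_r) u : vcoef (v + w) u = vcoef v u + vcoef w u.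
Proof. by rewrite /vcoef mxE mcoeffD. Qed.

Lemma vcoefB r (v w : 'rV[R]_r) u : vcoef (v - w) u = vcoef v u - vcoef w u.
Proof. by rewrite /vcoef !mxE mcoeffB. Qed.

Lemma mem_vec_supp r (v : 'rV[R]_r) u : (u \in vec_supp v) = (vcoef v u != 0).
Proof.
apply/allpairsPdep/idP => [[k [m [_ mv ->]]]|uv];
  first by rewrite -mcoeff_msupp.
by exists u.2, u.1; rewrite mem_enum mcoeff_msupp; case: u uv.
Qed.

Lemma vcoef_shift r c a (v : 'rV[R]_r) u :
  vcoef ((c *: 'X_[a]) *: v) (mshift a u) = c * vcoef v u.
Proof.
by rewrite /vcoef mxE -scalerAl mcoeffZ /= ['X_[_] * _]mulrC mcoeffMX.
Qed.

Lemma vcoef_term r c a (k : 'I_r) u :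
  vcoef ((c *: 'X_[a]) *: delta_mx 0 k) u = c *+ (u == (a, k)).
Proof.
case: u => b l; rewrite /vcoef /= !mxE /= xpair_eqE andbC.
case: (l == k); last by rewrite mulr0 mcoeff0.
by rewrite mulr1 mcoeffZ mcoeffX eq_sym mulr_natr.
Qed.

Lemma mcoeffM_neq0 (p q : R) m : (p * q)@_m != 0 ->
  exists a b, [/\ p@_a != 0, q@_b != 0 & m = (a + b)%MM].
Proof.
rewrite -mcoeff_msupp => /msuppM_le /allpairsP [[a b] /= [pa qb ->]].
by exists a, b; rewrite -!mcoeff_msupp.
Qed.

(** Cancellation can only remove monomials. The weight and degree estimates for products rest on
    this. *)
Lemma vcoef_mul r s (x : 'rV[R]_s) (B : 'M[R]_(s, r)) w :
  vcoef (x *m B) w != 0 ->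
  exists u t, [/\ vcoef x u != 0, vcoef (row u.2 B) t != 0
                & w = mshift u.1 t].
Proof.
rewrite /vcoef mxE raddf_sum /= => sum_neq0.
have [l _] : exists2 l, true & (x 0 l * B l w.2)@_(w.1) != 0.
  apply: NNPP => no_l; case/negP: sum_neq0; apply/eqP/big1 => l _.
  by apply/eqP/negPn/negP => ?; apply: no_l; exists l.
move=> /mcoeffM_neq0 [a [b [xa Bb wE]]].
by exists (a, l), (b, w.2); rewrite mxE; split=> //; rewrite /mshift /= -wE;
  case: w {sum_neq0 Bb wE}.
Qed.

Lemma vcoef_scale r c a (v : 'rV[R]_r) u :
  vcoef ((c *: 'X_[a]) *: v) u != 0 ->
  exists2 w, vcoef v w != 0 & u = mshift a w.
Proof.
rewrite /vcoef mxE => /mcoeffM_neq0 [a' [b [+ vb uE]]].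
rewrite mcoeffZ mcoeffX; case: (a =P a') => [-> _|_];
  last by rewrite mulr0 eqxx.
by exists (b, u.2) => //; rewrite /mshift -uE -surjective_pairing.
Qed.

(** One truncation serves two purposes: cutting rows down to a given weight and cutting lifts down
    to a given degree. *)
Definition restriction r (P : pred (mmon n r)) (v : 'rV[R]_r) : 'rV[R]_r :=
  \row_k \sum_(m <- msupp (v 0 k) | P (m, k)) (v 0 k)@_m *: 'X_[m].

Lemma vcoef_restriction r (P : pred (mmon n r)) (v : 'rV[R]_r) u :
  vcoef (restriction P v) u = if P u then vcoef v u else 0.
Proof.
case: u => a k; rewrite /vcoef mxE /= raddf_sum /=.
under eq_bigr do rewrite mcoeffZ mcoeffX.
have [va|va] := boolP (a \in msupp (v 0 k)); last first.
  rewrite big1_seq => [|b /andP[_ vb]].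
    by case: ifP => // _; rewrite memN_msupp_eq0.
  by case: (b =P a) => [ba|]; rewrite ?mulr0 //; rewrite ba (negPf va) in vb.
rewrite big_mkcond (bigD1_seq a) ?msupp_uniq //= eqxx mulr1.
rewrite big1 ?addr0 // => b /negPf ->.
by rewrite mulr0 if_same.
Qed.

End Coefficients.

(** * Leading monomials, pulled back orderings and division *)

Section LeadingMonomials.

Context (K : fieldType) (n : nat).
Local Notation R := {mpoly K[n]}.

Definition max_supp r (ltF : rel (mmon n r)) (v : 'rV[R]_r) (u : mmon n r) :=
  vcoef v u != 0 /\ forall w, vcoef v w != 0 -> (w == u) || ltF w u.

Lemma LM_max_supp r (ltF : rel (mmon n r)) (v : 'rV[R]_r) u :
  LM ltF v = Some u -> max_supp ltF v u.
Proof.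
rewrite /LM; case E: [seq _ <- _ | _] => [//|u' s] /= [u'u].
have : u' \in u' :: s by rewrite mem_head.
rewrite -E mem_filter u'u => /andP[/allP max_u]; rewrite mem_vec_supp => uv.
by split=> // w wv; apply: max_u; rewrite mem_vec_supp.
Qed.

(** Irreflexivity and transitivity make the maximum unique, so the filtered list whose head [LM]
    takes contains nothing but [u]. *)
Lemma max_supp_LM r (ltF : rel (mmon n r)) (v : 'rV[R]_r) u :
  strict_total ltF -> max_supp ltF v u -> LM ltF v = Some u.
Proof.
move=> [ltxx ltt _] [uv max_u].
rewrite /LM; set s := [seq _ <- _ | _].
have us : u \in s.
  rewrite mem_filter mem_vec_supp uv andbT; apply/allP=> w.
  by rewrite mem_vec_supp; apply: max_u.
suff s_u w : w \in s -> w = u.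
  by move: us s_u; case: s => //= u' s _ /(_ _ (mem_head _ _)) ->.
rewrite mem_filter mem_vec_supp => /andP[/allP max_w wv].
have := max_w u; rewrite mem_vec_supp => /(_ uv) /orP[/eqP //|uw].
have /orP[/eqP //|wu] := max_u w wv.
by have := ltt _ _ _ uw wu; rewrite ltxx.
Qed.

Lemma LM_exists r (ltF : rel (mmon n r)) (v : 'rV[R]_r) :
  strict_total ltF -> v != 0 -> exists u, LM ltF v = Some u.
Proof.
move=> lt_tot v0; have [ltxx ltt ltc] := lt_tot.
suff [u uv max_u] : exists2 u, u \in vec_supp v
    & forall w, w \in vec_supp v -> (w == u) || ltF w u.
  exists u; apply: max_supp_LM => //; split=> [|w wv];
    first by rewrite -mem_vec_supp.
  by apply: max_u; rewrite mem_vec_supp.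
have : vec_supp v != [::].
  apply: contra v0 => /eqP supp0; apply/eqP/vcoef_inj => u; rewrite vcoef0.
  by apply/eqP/negPn; rewrite -mem_vec_supp supp0.
elim: (vec_supp v) => // u s IHs _; have [->|s0] := eqVneq s [::].
  by exists u => [|w]; rewrite ?mem_head // inE => ->.
have [u' u's max_u'] := IHs s0.
have [uu'|neq_uu'] := eqVneq u u'.
  exists u; first exact: mem_head.
  by move=> w; rewrite inE => /orP[->//|]; rewrite uu'; apply: max_u'.
have /orP[uu'|u'u] := ltc _ _ neq_uu'.
  exists u'; first by rewrite inE u's orbT.
  by move=> w; rewrite inE => /orP[/eqP->|]; [rewrite uu' orbT | apply: max_u'].
exists u; first exact: mem_head.
move=> w; rewrite inE => /orP[->//|/max_u' /orP[/eqP->|wu']];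
  first by rewrite u'u orbT.
by rewrite (ltt _ _ _ wu' u'u) orbT.
Qed.

Lemma LM_shift r (lt : rel 'X_{1..n}) (ltF : rel (mmon n r)) a
    (v : 'rV[R]_r) u :
  module_ordering lt ltF -> LM ltF v = Some u ->
  LM ltF ('X_[a] *: v) = Some (mshift a u).
Proof.
move=> [lt_tot _ ltD] /LM_max_supp [uv max_u]; apply: max_supp_LM => //.
rewrite -['X_[a]]scale1r; split=> [|w /vcoef_scale [t tv ->]].
  by rewrite vcoef_shift mul1r.
by have /orP[/eqP->|tu] := max_u t tv; rewrite ?eqxx // orbC; apply/orP; left;
  apply: ltD.
Qed.

Context (lt : rel 'X_{1..n}) (lt_ordering : monomial_ordering lt).

Section Pullback.

Context (r s : nat) (ltF : rel (mmon n r))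
  (ltF_ordering : module_ordering lt ltF).
Context (B : 'M[R]_(s, r)) (lm : 'I_s -> mmon n r).
Context (LM_B : forall k, LM ltF (row k B) = Some (lm k)).
Context (prec : rel 'I_s) (prec_total : strict_total prec).

Lemma pullbackE u w :
  pullback_ordering ltF B prec u w =
  ltF (mshift u.1 (lm u.2)) (mshift w.1 (lm w.2))
  || (mshift u.1 (lm u.2) == mshift w.1 (lm w.2)) && prec w.2 u.2.
Proof. by rewrite /pullback_ordering !(LM_shift _ ltF_ordering (LM_B _)). Qed.

Lemma pullback_module_ordering :
  module_ordering lt (pullback_ordering ltF B prec).
Proof.
have [[ltxx ltt ltc] lt_ext ltD] := ltF_ordering.
have [pxx pt pc] := prec_total.
have [_ ladd _] := lt_ordering.
split; first split.
- by move=> u; rewrite pullbackE ltxx pxx andbF.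
- move=> u t w; rewrite !pullbackE.
  move=> /orP[tu|/andP[/eqP tu put]] /orP[uw|/andP[/eqP uw pwu]].
  + by rewrite (ltt _ _ _ tu uw).
  + by rewrite -uw tu.
  + by rewrite tu uw.
  + by rewrite tu uw eqxx (pt _ _ _ pwu put) orbT.
- move=> u w neq_uw; rewrite !pullbackE.
  have [E|/ltc/orP[->//|->]] :=
    eqVneq (mshift u.1 (lm u.2)) (mshift w.1 (lm w.2)); last by rewrite orbT.
  (* Distinct monomials with the same image sit at different positions, since at equal positions the
     exponents would cancel to equality; [prec] then decides. *)
  rewrite E ltxx /= orbC; apply: pc; apply: contra neq_uw => /eqP E2.
  move/(congr1 fst): E; rewrite /mshift E2 /= => /addIm E1.
  by case: u w E1 E2 => [? ?] [? ?] /= -> ->.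
- move=> a b k ab; rewrite pullbackE /= /mshift; apply/orP; left.
  by apply: lt_ext; rewrite ![(_ + (lm k).1)%MM]addmC; apply: ladd.
- move=> c u w; rewrite !pullbackE /= -!mshiftA.
  move=> /orP[uw|/andP[/eqP-> ->]]; last by rewrite eqxx orbT.
  by rewrite [ltF _ _]ltD.
Qed.

End Pullback.

Section Division.

Context (r s : nat) (ltF : rel (mmon n r))
  (ltF_ordering : module_ordering lt ltF).
Context (N : 'rV[R]_r -> Prop) (N_sub : is_submodule N).
Context (B : 'M[R]_(s, r)) (lm : 'I_s -> mmon n r).
Context (LM_B : forall k, LM ltF (row k B) = Some (lm k)).
Context (B_groebner : groebner_basis ltF N (rows B)).

Lemma row_in_rows k : row k B \in rows B.
Proof. by apply: (map_f (fun u => row u B)); rewrite mem_enum. Qed.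

Lemma vcoef_lm k : vcoef (row k B) (lm k) = 1.
Proof.
have [_ /(_ _ (row_in_rows k)) [u]] := B_groebner; rewrite LM_B => -[->].
by rewrite /vcoef.
Qed.

(** The monomial [u] is a combination of leading monomials of rows, and some summand must contribute
    to its coefficient. *)
Lemma groebner_divides v u : N v -> LM ltF v = Some u ->
  exists a k, u = mshift a (lm k).
Proof.
move=> Nv LMv; have [_ _ /(_ (mmon_vec K u)) [+ _]] := B_groebner.
case=> [|l [l_lm]].
  exists [:: (1, mmon_vec K u)]; split; last by rewrite big_seq1 scale1r.
  by move=> t; rewrite inE => /eqP -> /=; split=> //; exists v, u.
move=> uE; have : vcoef (mmon_vec K u) u != 0.
  by rewrite -[mmon_vec K u]/(_ *: _) -['X_[_]]scale1r vcoef_term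
    -surjective_pairing eqxx oner_eq0.
rewrite uE; elim: l l_lm {uE} => [|t l IHl] l_lm;
  first by rewrite big_nil vcoef0 eqxx.
rewrite big_cons vcoefD; have [->|tu _] := eqVneq (vcoef (t.1 *: t.2) u) 0.
  by rewrite add0r; apply: IHl => t' t'l; apply: l_lm; rewrite inE t'l orbT.
have [_ [g [w [/mapP[k _ ->] LMg tE]]]] := l_lm t (mem_head _ _).
move: LMg; rewrite LM_B => -[wE].
move: tu; rewrite /vcoef tE mxE => /mcoeffM_neq0 [a [b [_ + u1E]]].
rewrite /mmon_vec !mxE eqxx /=; case: (u.2 =P w.2) => [u2E|_];
  last by rewrite mulr0 mcoeff0 eqxx.
rewrite mulr1 mcoeffX; case: (w.1 =P b) => [w1E _|_]; last by rewrite eqxx.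
by exists a, k; rewrite wE [u]surjective_pairing u1E u2E -w1E.
Qed.

(** The rows being monic, the term at [u] cancels exactly, and every other subtracted term lies
    below [u]. *)
Lemma division_step v u : N v -> LM ltF v = Some u ->
  exists a k, u = mshift a (lm k) /\
    let v' := v - (vcoef v u *: 'X_[a]) *: row k B in
    forall w, vcoef v' w != 0 -> ltF w u.
Proof.
move=> Nv LMv; have [a [k uE]] := groebner_divides Nv LMv; exists a, k;
  split=> // v' w.
have [_ _ ltD] := ltF_ordering.
have [uv max_u] := LM_max_supp LMv.
have [_ max_k] := LM_max_supp (LM_B k).
have [-> /negP[]|neq_wu] := eqVneq w u.
  by rewrite vcoefB [X in vcoef (_ *: _) X]uE vcoef_shift vcoef_lm mulr1 subrr.
have [wv _|/negPn/eqP wv] := boolP (vcoef v w != 0).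
  by have := max_u w wv; rewrite (negPf neq_wu).
rewrite vcoefB wv sub0r oppr_eq0 => /vcoef_scale [t /max_k tk wE].
have {tk} /orP[/eqP tk|tk] := tk; last by rewrite wE uE; apply: ltD.
by rewrite wE uE tk eqxx in neq_wu.
Qed.

(** Repeated division, by well-founded induction on [u]: the first recorded term maps exactly to
    [u], later ones strictly below. *)
Lemma standard_representation_exists v u : N v -> LM ltF v = Some u ->
  exists2 x, v = x *m B
    & forall w, vcoef x w != 0 ->
        mshift w.1 (lm w.2) = u \/ ltF (mshift w.1 (lm w.2)) u.
Proof.
have [lt_tot _ _] := ltF_ordering; have [_ ltt _] := lt_tot.
have [_ ND NZ] := N_sub; have [B_N _ _] := B_groebner.
elim/(well_founded_ind (module_ordering_wf lt_ordering ltF_ordering)): u v =>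
  u IHu v Nv LMv.
have [a [k [uE]]] := division_step Nv LMv; set c := _ *: 'X_[a].
set v' := v - _ => /= v'_lt.
have vE : v = v' + (c *: delta_mx 0 k) *m B.
  by rewrite -scalemxAl -rowE subrK.
have Nv' : N v' by rewrite /v' -scaleNr; apply/ND/NZ/B_N/row_in_rows.
have term_le w :
    vcoef (c *: delta_mx 0 k : 'rV_s) w != 0 -> mshift w.1 (lm w.2) = u.
  by rewrite vcoef_term; case: (w =P (a, k)) => [->|_]; rewrite ?uE ?eqxx.
have [v'0|v'0] := eqVneq v' 0.
  exists (c *: delta_mx 0 k); first by rewrite {1}vE v'0 add0r.
  by move=> w /term_le; left.
have [u' LMv'] := LM_exists lt_tot v'0.
have u'u : ltF u' u by apply: v'_lt; have [] := LM_max_supp LMv'.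
have [x v'E x_le] := IHu u' u'u v' Nv' LMv'.
exists (x + c *: delta_mx 0 k); first by rewrite mulmxDl -v'E.
move=> w; rewrite vcoefD; have [->|xw _] := eqVneq (vcoef x w) 0.
  by rewrite add0r => /term_le; left.
by right; have [->//|/ltt] := x_le w xw; apply.
Qed.

End Division.
End LeadingMonomials.

(** * Weights and exactness of the initial complex *)

Section InitialForms.

Context (K : fieldType) (n : nat).
Local Notation R := {mpoly K[n]}.
Context (lt : rel 'X_{1..n}) (lt_ordering : monomial_ordering lt).
Context (e : nat) (lt0 : rel (mmon n e))
  (lt0_ordering : module_ordering lt lt0).

(** These two properties of the iterated weight survive the pullback and are all that one step of
    the construction uses. *)
Definition weight_function r (ltF : rel (mmon n r))
    (wt : mmon n r -> mmon n e) : Prop :=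
  (forall a u, wt (mshift a u) = mshift a (wt u))
  /\ (forall u w, ltF u w -> wt u = wt w \/ lt0 (wt u) (wt w)).

Definition pullback_weight r s (wt : mmon n r -> mmon n e)
    (lm : 'I_s -> mmon n r) (u : mmon n s) : mmon n e :=
  mshift u.1 (wt (lm u.2)).

Definition initial_form r s (wt : mmon n r -> mmon n e) (lm : 'I_s -> mmon n r)
    (B : 'M[R]_(s, r)) : 'M[R]_(s, r) :=
  \matrix_k restriction [pred u | wt u == wt (lm k)] (row k B).

Lemma vcoef_initial_form r s wt lm (B : 'M[R]_(s, r)) k u :
  vcoef (row k (initial_form wt lm B)) u
  = if wt u == wt (lm k) then vcoef (row k B) u else 0.
Proof. by rewrite rowK vcoef_restriction. Qed.

Lemma lt0_trans_or a b c : a = b \/ lt0 a b -> lt0 b c -> lt0 a c.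
Proof.
have [[_ ltt _] _ _] := lt0_ordering.
by case=> [-> //|/ltt]; apply.
Qed.

Section Step.

Context (r s : nat) (ltF : rel (mmon n r))
  (ltF_ordering : module_ordering lt ltF).
Context (B : 'M[R]_(s, r)) (lm : 'I_s -> mmon n r).
Context (LM_B : forall k, LM ltF (row k B) = Some (lm k)).
Context (prec : rel 'I_s) (prec_total : strict_total prec).
Context (wt : mmon n r -> mmon n e) (wtP : weight_function ltF wt).

Local Notation ltF' := (pullback_ordering ltF B prec).
Local Notation wt' := (pullback_weight wt lm).
Local Notation B0 := (initial_form wt lm B).

Lemma pullback_weight_function : weight_function ltF' wt'.
Proof.
have [wt_shift wt_mono] := wtP.
split=> [a u|u w]; first by rewrite /pullback_weight /= -mshiftA.
rewrite (pullbackE ltF_ordering LM_B) /pullback_weight -!wt_shift.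
by move=> /orP[/wt_mono|/andP[/eqP-> _]]; [|left].
Qed.

Lemma weight_mul_initial (x : 'rV_s) w : vcoef (x *m B0) w != 0 ->
  exists2 u, vcoef x u != 0 & wt w = wt' u.
Proof.
have [wt_shift _] := wtP.
case/vcoef_mul=> u [v [xu + ->]]; rewrite vcoef_initial_form.
case: ifP => [/eqP vu _|]; last by rewrite eqxx.
by exists u; rewrite // wt_shift vu.
Qed.

(** Terms of a row of [B] have at most the weight of its leading monomial, and those of equal weight
    cancel in [B - B0]. *)
Lemma weight_mul_remainder (x : 'rV_s) w : vcoef (x *m (B - B0)) w != 0 ->
  exists2 u, vcoef x u != 0 & lt0 (wt w) (wt' u).
Proof.
have [wt_shift wt_mono] := wtP; have [_ _ lt0D] := lt0_ordering.
case/vcoef_mul=> u [v [xu + ->]].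
rewrite linearB /= vcoefB vcoef_initial_form.
have [_|vu] := eqVneq (wt v) (wt (lm u.2)); first by rewrite subrr eqxx.
rewrite subr0 => Bv; exists u => //; rewrite wt_shift; apply: lt0D.
have [_ /(_ v Bv) /orP[/eqP vE|/wt_mono[vE|//]]] := LM_max_supp (LM_B u.2).
- by rewrite vE eqxx in vu.
- by rewrite vE eqxx in vu.
Qed.

Lemma weight_mul (x : 'rV_s) w : vcoef (x *m B) w != 0 ->
  exists2 u, vcoef x u != 0 & wt w = wt' u \/ lt0 (wt w) (wt' u).
Proof.
rewrite -[B](subrK B0) mulmxDr vcoefD.
have [->|/weight_mul_remainder [u xu uw] _] :=
  eqVneq (vcoef (x *m (B - B0)) w) 0.
  by rewrite add0r => /weight_mul_initial [u xu uw]; exists u => //; left.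
by exists u => //; right.
Qed.

Context (N : 'rV[R]_r -> Prop) (N_sub : is_submodule N).
Context (B_groebner : groebner_basis ltF N (rows B)).

Context (t : nat) (C : 'M[R]_(t, s)) (lmC : 'I_t -> mmon n s).
Context (LM_C : forall k, LM ltF' (row k C) = Some (lmC k)).
Context (C_groebner : groebner_basis ltF' (kernel B) (rows C)).
Local Notation C0 := (initial_form wt' lmC C).

(** The product has weight [wt' (lmC k)] throughout, yet [row k C *m B = 0] rewrites it as a sum of
    terms of strictly smaller weight. *)
Lemma row_initial_form_kernel k : kernel B0 (row k C0).
Proof.
have [[lt0xx _ _] _ _] := lt0_ordering.
have [_ wt'_mono] := pullback_weight_function.
have C0_weight u : vcoef (row k C0) u != 0 -> wt' u = wt' (lmC k).
  by rewrite vcoef_initial_form; case: ifP => [/eqP|]; rewrite // eqxx.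
have rem_weight u :
    vcoef (row k C - row k C0) u != 0 -> lt0 (wt' u) (wt' (lmC k)).
  rewrite vcoefB vcoef_initial_form.
  have [_|ne] := eqVneq (wt' u) (wt' (lmC k)); first by rewrite subrr eqxx.
  rewrite subr0 => Cu.
  by have [_ /(_ u Cu) /orP[/eqP E|/wt'_mono[E|//]]] := LM_max_supp (LM_C k);
    rewrite E eqxx in ne.
have CB : row k C *m B = 0.
  by have [H _ _] := C_groebner; apply/H/row_in_rows.
apply: vcoef_inj => w; rewrite vcoef0; apply/eqP/negPn/negP => C0B0.
have [u /C0_weight wtu wtw] := weight_mul_initial C0B0.
rewrite wtu in wtw; suff : lt0 (wt w) (wt w) by rewrite lt0xx.
(* Split the row of [C] into initial form and remainder, and [B] only where it meets the initial
   form. *)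
have E : row k C0 *m B0
    = - (row k C0 *m (B - B0) + (row k C - row k C0) *m B).
  by rewrite mulmxBr mulmxBl CB sub0r addrC addrA addNr sub0r opprK.
move: C0B0; rewrite E -sub0r vcoefB vcoef0 sub0r oppr_eq0 vcoefD {2}wtw.
have [->|/weight_mul_remainder [u' /C0_weight <- //]] :=
  eqVneq (vcoef (row k C0 *m (B - B0)) w) 0.
rewrite add0r => /weight_mul [u' /rem_weight u'k wu'].
exact: lt0_trans_or wu' u'k.
Qed.

(** The converse inclusion is division by the rows of [C0], by well-founded induction on the leading
    monomial of [v]. *)
Lemma initial_form_exact (v : 'rV_s) :
  kernel B0 v <-> exists w : 'rV_t, v = w *m C0.
Proof.
have ltF'_ordering := pullback_module_ordering lt_ordering ltF_ordering LM_B
  prec_total.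
have [ltF'_total _ ltF'D] := ltF'_ordering.
have [ltF_total _ _] := ltF_ordering.
have [ltxx ltt ltc] := ltF'_total.
have [[lt0xx lt0t _] _ _] := lt0_ordering.
have [_ wt'_mono] := pullback_weight_function.
have [wt_shift wt_mono] := wtP.
have [B_N _ _] := B_groebner.
have [ND0 ND NZ] := N_sub.
have vBN (x : 'rV_s) : N (x *m B).
  rewrite mulmx_sum_row; apply: big_ind => // k _.
  by apply/NZ/B_N/row_in_rows.
split=> [kv|[w ->]]; last first.
  rewrite /kernel -mulmxA (_ : C0 *m B0 = 0) ?mulmx0 //.
  by apply/row_matrixP=> k; rewrite row_mul row0;
    apply: row_initial_form_kernel.
have [->|v0] := eqVneq v 0; first by exists 0; rewrite mul0mx.
have [u LMv] := LM_exists ltF'_total v0.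
elim/(well_founded_ind (module_ordering_wf lt_ordering ltF'_ordering)): u v kv
  v0 LMv => u IHu v kv v0 LMv.
have [uv max_u] := LM_max_supp LMv.
(* As [v] is killed by [B0], only the weight-lowering part of [B] acts on it. *)
have vB_weight w : vcoef (v *m B) w != 0 -> lt0 (wt w) (wt' u).
  have -> : v *m B = v *m (B - B0) by rewrite mulmxBr kv subr0.
  case/weight_mul_remainder=>
    u' /max_u /orP[/eqP-> //|/wt'_mono [->//|u'u] wu'].
  exact: lt0t wu' u'u.
(* Division of [v *m B] yields [x] with terms of smaller weight than [u]; by monotonicity of the
   weight and totality they are also below [u] in the ordering. *)
have [x vBE x_lt] : exists2 x, v *m B = x *m B
    & forall w, vcoef x w != 0 -> ltF' w u.
  have [vB0|vB0] := eqVneq (v *m B) 0.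
    by exists 0 => [|w]; rewrite ?mul0mx // vcoef0 eqxx.
  have [u' LMvB] := LM_exists ltF_total vB0.
  have [x vBE x_le] := standard_representation_exists lt_ordering ltF_ordering
    N_sub LM_B B_groebner (vBN v) LMvB.
  exists x => // w /x_le w_le.
  have wu : lt0 (wt' w) (wt' u).
    have [u'vB _] := LM_max_supp LMvB.
    apply: lt0_trans_or (vB_weight _ u'vB); rewrite /pullback_weight -wt_shift.
    by case: w_le => [->|/wt_mono //]; left.
  have neq_wu : w != u by apply/eqP=> wuE; rewrite wuE lt0xx in wu.
  have /orP[//|/wt'_mono [E|uw]] := ltc _ _ neq_wu;
    first by rewrite E lt0xx in wu.
  by have := lt0t _ _ _ uw wu; rewrite lt0xx.
have kvx : kernel B (v - x) by rewrite /kernel mulmxBl vBE subrr.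
have LMvx : LM ltF' (v - x) = Some u.
  apply: max_supp_LM => //; split=> [|w].
    rewrite vcoefB; have [->|/x_lt] := eqVneq (vcoef x u) 0;
      first by rewrite subr0.
    by rewrite ltxx.
  rewrite vcoefB; have [->|/x_lt -> _] := eqVneq (vcoef x w) 0;
    last by rewrite orbT.
  by rewrite subr0; apply: max_u.
have [a [k uE]] := groebner_divides LM_C C_groebner kvx LMvx.
(* The divisor found for [v - x] is used on [v] itself, with the row of [C0] in place of that of
   [C]: both rows have the leading term [lmC k] with coefficient 1, and the difference stays in the
   kernel of [B0]. *)
set c := vcoef v u *: 'X_[a] : R.
have v'_lt w : vcoef (v - c *: row k C0) w != 0 -> ltF' w u.
  have lm1 : vcoef (row k C0) (lmC k) = 1.
    by rewrite vcoef_initial_form eqxx (vcoef_lm LM_C C_groebner).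
  have [->|neq_wu] := eqVneq w u.
    by rewrite vcoefB {2}uE vcoef_shift lm1 mulr1 subrr eqxx.
  rewrite vcoefB; have [->|/max_u] := eqVneq (vcoef v w) 0;
    last by rewrite (negPf neq_wu).
  rewrite sub0r oppr_eq0 => /vcoef_scale [t' + wE].
  rewrite vcoef_initial_form; case: ifP => [_ Ct'|]; last by rewrite eqxx.
  have [_ /(_ t' Ct') /orP[/eqP t'k|t'k]] := LM_max_supp (LM_C k).
    by rewrite wE uE t'k eqxx in neq_wu.
  by rewrite wE uE; apply: ltF'D.
have kv' : kernel B0 (v - c *: row k C0).
  by rewrite /kernel mulmxBl kv -scalemxAl row_initial_form_kernel scaler0
    subr0.
have [w v'E] : exists w : 'rV_t, v - c *: row k C0 = w *m C0.
  have [->|v'0] := eqVneq (v - c *: row k C0) 0.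
    by exists 0; rewrite mul0mx.
  have [u' LMv'] := LM_exists ltF'_total v'0.
  have [/v'_lt u'u _] := LM_max_supp LMv'.
  exact: IHu u'u _ kv' v'0 LMv'.
by exists (w + c *: delta_mx 0 k); rewrite mulmxDl -v'E -scalemxAl -rowE subrK.
Qed.

End Step.
End InitialForms.

(** * Comparison of resolutions and invariance of graded Betti numbers *)

Section Comparison.

Context (K : fieldType) (n : nat).
Local Notation R := {mpoly K[n]}.

(** Reduction modulo the maximal ideal, with values in the residue field [K]. *)
Definition constant_part r s (B : 'M[R]_(s, r)) : 'M[K]_(s, r) :=
  map_mx (mcoeff 0%MM) B.

Lemma constant_partM r s t (B : 'M[R]_(s, r)) (C : 'M[R]_(t, s)) :
  constant_part (C *m B) = constant_part C *m constant_part B.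
Proof. exact: map_mxM. Qed.

Lemma max_ideal_mulP r (v : 'rV[R]_r) : max_ideal_mul v <-> constant_part v = 0.
Proof.
split=> [[l [l_max ->]]|v0].
  rewrite /constant_part raddf_sum big_seq big1 // => t /l_max [t0 _].
  apply/rowP=> k; rewrite !mxE;
    apply/eqP/negPn/negP => /mcoeffM_neq0 [a [b [ta _]]].
  move/esym/eqP; rewrite mnmD_eq0 => /andP[/eqP a0 _].
  by move: t0 ta; rewrite /max_ideal mcoeff_msupp a0 => /negPn ->.
exists [seq (v 0 k, delta_mx 0 k) | k <- enum 'I_r]; split.
  move=> _ /mapP[k _ ->]; split=> //=; rewrite /max_ideal mcoeff_msupp negbK.
  by have /rowP/(_ k) := v0; rewrite !mxE => ->.
by rewrite big_map big_enum /=; apply: row_sum_delta.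
Qed.

Lemma max_ideal_mulmxP r s (B : 'M[R]_(s, r)) :
  (forall v : 'rV_s, max_ideal_mul (v *m B)) <-> constant_part B = 0.
Proof.
split=> [Bmax|B0 v]; last first.
  by apply/max_ideal_mulP; rewrite constant_partM B0 mulmx0.
apply/row_matrixP=> k; rewrite row0 -map_row rowE.
exact/max_ideal_mulP/Bmax.
Qed.

Lemma lift_mulmx r s t (B : 'M[R]_(s, r)) (X : 'M[R]_(t, r)) :
  (forall k, exists w : 'rV_s, row k X = w *m B) -> exists Y, X = Y *m B.
Proof.
move=> /fin_all_exists [y yP]; exists (\matrix_k y k).
by apply/row_matrixP=> k; rewrite row_mul rowK.
Qed.

Context (A : zmodType) (deg : 'X_{1..n} -> A) (deg_add : monomial_grading deg).

Definition homogeneous_matrix r s (bdeg : 'I_r -> A) (cdeg : 'I_s -> A)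
    (B : 'M[R]_(s, r)) : Prop :=
  forall k, homogeneous deg bdeg (cdeg k) (row k B).

Lemma monomial_grading0 : deg 0%MM = 0.
Proof. by apply: (addIr (deg 0%MM)); rewrite -deg_add add0r addm0. Qed.

Lemma homogeneousP r (bdeg : 'I_r -> A) j (v : 'rV[R]_r) :
  homogeneous deg bdeg j v <->
  forall u, vcoef v u != 0 -> deg u.1 + bdeg u.2 = j.
Proof.
split=> [vj [m k] uv|vj k m]; first by apply: vj; rewrite mcoeff_msupp.
by rewrite mcoeff_msupp; apply: (vj (m, k)).
Qed.

Lemma homogeneous_mul r s (bdeg : 'I_r -> A) (cdeg : 'I_s -> A)
    (B : 'M[R]_(s, r)) (x : 'rV_s) w :
  homogeneous_matrix bdeg cdeg B -> vcoef (x *m B) w != 0 ->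
  exists2 u, vcoef x u != 0 & deg w.1 + bdeg w.2 = deg u.1 + cdeg u.2.
Proof.
move=> hB /vcoef_mul [u [t [xu Bt ->]]]; exists u => //=.
by have /homogeneousP/(_ t Bt) <- := hB u.2; rewrite deg_add addrA.
Qed.

(** Any lift can be truncated to the right degree: [B] preserves degrees, so the discarded terms
    contribute nothing. *)
Lemma homogeneous_lift r s t (bdeg : 'I_r -> A) (cdeg : 'I_s -> A)
    (ddeg : 'I_t -> A) (B : 'M[R]_(s, r)) (X : 'M[R]_(t, r)) :
  homogeneous_matrix bdeg cdeg B -> homogeneous_matrix bdeg ddeg X ->
  (forall k, exists w : 'rV_s, row k X = w *m B) ->
  exists2 Y, X = Y *m B & homogeneous_matrix cdeg ddeg Y.
Proof.
move=> hB hX X_im; suff /fin_all_exists2 [y yX hy] k : exists2 y : 'rV_s,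
    row k X = y *m B & homogeneous deg cdeg (ddeg k) y.
  exists (\matrix_k y k); last by move=> k; rewrite rowK.
  by apply/row_matrixP=> k; rewrite row_mul rowK.
have [y yX] := X_im k.
pose y' := restriction [pred u | deg u.1 + cdeg u.2 == ddeg k] y.
have y'k u : vcoef y' u != 0 -> deg u.1 + cdeg u.2 = ddeg k.
  by rewrite vcoef_restriction /=; case: ifP => [/eqP|]; rewrite // eqxx.
have yk u : vcoef (y - y') u != 0 -> deg u.1 + cdeg u.2 != ddeg k.
  rewrite vcoefB vcoef_restriction /=.
  by case: ifP => [_|/negbT //]; rewrite subrr eqxx.
exists y'; last exact/homogeneousP.
(* The difference lies in degree [ddeg k] and in the other degrees at once. *)
apply: vcoef_inj => w; apply/eqP; rewrite -subr_eq0 -vcoefB.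
apply/negPn/negP => Xw.
have XE : row k X - y' *m B = (y - y') *m B by rewrite yX mulmxBl.
move: (Xw); rewrite XE => /(homogeneous_mul hB) [u /yk/eqP yu wu]; apply: yu.
rewrite -wu; have [Xk|Xk] := eqVneq (vcoef (row k X) w) 0.
  move: Xw; rewrite vcoefB Xk sub0r oppr_eq0.
  by case/(homogeneous_mul hB) => u' /y'k <-.
by have /homogeneousP/(_ w Xk) := hX k.
Qed.

(** Modulo the maximal ideal [Y] links only basis elements of equal degree, so the degree [j] block
    of the identity factors through a space of dimension the right-hand count. *)
Lemma count_le_of_constant_inverse r s (bdeg : 'I_r -> A) (cdeg : 'I_s -> A)
    (Y : 'M[R]_(s, r)) (Z : 'M[R]_(r, s)) j :
  homogeneous_matrix bdeg cdeg Y -> constant_part (Y *m Z) = 1%:M ->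
  (#|[set k | cdeg k == j]| <= #|[set l | bdeg l == j]|)%N.
Proof.
move=> hY; rewrite constant_partM; set P := [set k | _];
  set Q := [set l | _] => YZ.
pose p (a : 'I_#|P|) := enum_val a; pose q (b : 'I_#|Q|) := enum_val b.
pose Y0 := mxsub p q (constant_part Y); pose Z0 := mxsub q p (constant_part Z).
apply: (@mulmx1_min _ _ _ Y0 Z0); apply/matrixP=> a b.
have /matrixP/(_ (enum_val a) (enum_val b)) := YZ.
rewrite !mxE (inj_eq enum_val_inj) => <-.
rewrite [RHS](bigID (mem Q)) /= [X in _ = _ + X]big1 ?addr0 => [|l lQ].
  rewrite [RHS]big_enum_val /=; apply: eq_bigr => l _.
  by rewrite !mxE.
(* A nonzero constant entry belongs to the monomial 1, of degree 0, so [l] would have degree [j] and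
   lie in [Q]. *)
rewrite mxE; have [->|Yl] := eqVneq (Y (enum_val a) l)@_0%MM 0;
  first by rewrite mul0r.
have Yal : vcoef (row (enum_val a) Y) (0%MM, l) != 0 by rewrite /vcoef mxE.
have /homogeneousP/(_ _ Yal) /= := hY (enum_val a).
rewrite monomial_grading0 add0r; have := enum_valP a; rewrite inE => /eqP -> lj.
by rewrite inE lj eqxx in lQ.
Qed.

Context (e : nat) (edeg : 'I_e -> A) (M : 'rV[R]_e -> Prop).

Definition in_image r s (B : 'M[R]_(s, r)) (v : 'rV_r) : Prop :=
  exists w : 'rV_s, v = w *m B.

Local Notation sbdeg F i := (@shifted_bdeg _ _ edeg _ (@bdeg _ _ _ _ F) i).

Section ChainMaps.

Context (F F' : free_sequence K n A e).

Definition shifted_map (i : nat) : Type :=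
  'M[R]_(shifted_rank e (rk F) i, shifted_rank e (rk F') i).

(** Preserving images is what the next lift requires, and it makes sense at index 0 too, where the
    image is [M]. *)
Definition chain_map_at i (f : shifted_map i) : Prop :=
  forall x, in_image (bmap F i) x -> in_image (bmap F' i) (x *m f).

Lemma chain_map_row i (f : shifted_map i) k :
  chain_map_at f -> in_image (bmap F' i) (row k (bmap F i *m f)).
Proof.
by move=> fP; rewrite row_mul; apply: fP; exists (delta_mx 0 k); rewrite -rowE.
Qed.

End ChainMaps.

Lemma chain_map_base (F F' : free_sequence K n A e) :
  graded_free_resolution deg edeg M F -> graded_free_resolution deg edeg M F' ->
  @chain_map_at F F' 0 1%:M.
Proof. by move=> [_ MF _] [_ MF' _] x; rewrite mulmx1 => /MF /MF'. Qed.

(** Exactness turns images into kernels, which the commuting square preserves. *)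
Lemma chain_map_step (F F' : free_sequence K n A e) i
    (f : shifted_map F F' i) (f' : 'M_(rk F i, rk F' i)) :
  graded_free_resolution deg edeg M F -> graded_free_resolution deg edeg M F' ->
  bmap F i *m f = f' *m bmap F' i -> @chain_map_at F F' i.+1 f'.
Proof.
move=> [_ _ exF] [_ _ exF'] ff' x /exF xF; apply/exF'.
by rewrite /kernel -mulmxA -ff' mulmxA xF mul0mx.
Qed.

(* [f] and [g] are the components on F_(i-1) of lifts of the identity, and [h]
   that of a homotopy from [f *m g] to the identity.  The equation for [h] is
   the one that holds before the component on F_(i-2) is subtracted; restricting
   it to the image of [bmap F i] keeps the induction local to one index. *)
Lemma comparison (F F' : free_sequence K n A e) :
  minimal_graded_free_resolution deg edeg M F ->
  graded_free_resolution deg edeg M F' ->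
  forall i, exists (f : shifted_map F F' i) (g : shifted_map F' F i)
    (h : 'M_(shifted_rank e (rk F) i, rk F i)),
  [/\ chain_map_at f, chain_map_at g,
     homogeneous_matrix (sbdeg F' i) (sbdeg F i) f
   & [/\ constant_part (f *m g) = 1%:M,
      forall x, in_image (bmap F i) x ->
        x *m (f *m g - 1%:M - h *m bmap F i) = 0
    & constant_part (bmap F i *m h) = 0]].
Proof.
move=> [resF minF] resF'; have [homF _ exF] := resF; have [homF' _ _] := resF'.
elim=> [|i [f [g [h [fP gP f_hom [fg1 fgh h0]]]]]].
  (* Minimality says nothing about [bmap F 0], so the constant part of [bmap F 0 *m h] vanishes only
     thanks to the choice [h = 0]. *)
  exists 1%:M, 1%:M, 0; split; try exact: chain_map_base.
    move=> k; apply/homogeneousP => -[m l]; rewrite /vcoef !mxE /=.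
    case: (k =P l) => [->|_]; last by rewrite mcoeff0 eqxx.
    rewrite mcoeff1; case: (m =P 0%MM) => [-> _|_]; last by rewrite eqxx.
    by rewrite monomial_grading0 add0r.
  rewrite /constant_part mulmx1 map_mx1 mulmx0 map_mx0; split=> // x _.
  by rewrite subrr mul0mx subr0 mulmx0.
have [f' ff' f'_hom] : exists2 f' : 'M_(rk F i, rk F' i),
    bmap F i *m f = f' *m bmap F' i
    & homogeneous_matrix (sbdeg F' i.+1) (sbdeg F i.+1) f'.
  apply: (homogeneous_lift (homF' i)); last by move=> k; apply: chain_map_row.
  move=> k; apply/homogeneousP => w;
    rewrite row_mul => /(homogeneous_mul f_hom) [u Fu ->].
  by have /homogeneousP/(_ u Fu) := homF i k.
have [g' gg'] :
    exists g' : 'M_(rk F' i, rk F i), bmap F' i *m g = g' *m bmap F i.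
  by apply: lift_mulmx => k; apply: chain_map_row.
(* This is what the next homotopy must lift: followed by the differential it becomes the expression
   killed by [fgh], so its rows are boundaries. *)
pose D := f' *m g' - 1%:M - bmap F i *m h.
have DF : D *m bmap F i = 0.
  have -> : D *m bmap F i = bmap F i *m (f *m g - 1%:M - h *m bmap F i).
    rewrite !mulmxBl !mulmxBr mul1mx mulmx1 -!mulmxA -gg' !mulmxA ff'.
    by rewrite -!mulmxA gg'.
  apply/row_matrixP=> k; rewrite row_mul row0; apply: fgh.
  by exists (delta_mx 0 k); rewrite -rowE.
have [h' Dh'] : exists h', D = h' *m bmap F i.+1.
  apply: lift_mulmx => k; apply/exF.
  by rewrite /kernel -row_mul DF row0.
have minFi : constant_part (bmap F i.+1) = 0 by apply/max_ideal_mulmxP/minF.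
exists f', g', h'; split=> //.
- exact: chain_map_step ff'.
- exact: chain_map_step gg'.
split.
(* Both corrections vanish modulo the maximal ideal, the first by [h0], the second by minimality. *)
- have -> : f' *m g' = 1%:M + bmap F i *m h + h' *m bmap F i.+1.
    by rewrite -Dh' /D -[X in _ = _ + X]addrA -opprD [RHS]addrC subrK.
  rewrite /constant_part !raddfD /= -!/(constant_part _) h0 constant_partM minFi
    mulmx0 !addr0.
  exact: map_mx1.
- move=> x /exF xF; rewrite -Dh' (_ : _ - D = bmap F i *m h);
  last by rewrite /D opprB addrC subrK.
  by rewrite mulmxA xF mul0mx.
- by rewrite constant_partM minFi mul0mx.
Qed.

(** Modulo the maximal ideal, the identity of [F] factors through [F'] with a degree-preserving
    first factor. *)
Lemma minimal_rank_le (F F' : free_sequence K n A e) i j :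
  minimal_graded_free_resolution deg edeg M F ->
  graded_free_resolution deg edeg M F' ->
  (#|[set u : 'I_(rk F i) | bdeg u == j]|
     <= #|[set u : 'I_(rk F' i) | bdeg u == j]|)%N.
Proof.
(* The shift to [i.+1] is there because index [i] refers to the maps on F_(i-1). *)
move=> minF resF'; have [f [g [h [_ _ f_hom [fg1 _ _]]]]] :=
  comparison minF resF' i.+1.
exact: count_le_of_constant_inverse f_hom fg1.
Qed.

(** The resolution picked by [epsilon] is minimal as well, so [minimal_rank_le] applies in both
    directions. *)
Lemma graded_betti_minimal (F : free_sequence K n A e) i j :
  minimal_graded_free_resolution deg edeg M F ->
  graded_betti deg edeg M i j = #|[set u : 'I_(rk F i) | bdeg u == j]|.
Proof.
move=> minF; rewrite /graded_betti.
have [|F' minF' ->] := epsilon_spec (inhabits 0%N) (fun b =>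
  exists2 F0 : free_sequence K n A e,
    minimal_graded_free_resolution deg edeg M F0
    & b = #|[set u : 'I_(rk F0 i) | bdeg u == j]|).
  by exists #|[set u : 'I_(rk F i) | bdeg u == j]|, F.
have [[resF _] [resF' _]] := (minF, minF').
by apply/eqP; rewrite eqn_leq !minimal_rank_le.
Qed.

End Comparison.

(** * The initial complex of a Schreyer resolution *)

Lemma kernel_is_submodule (K : fieldType) n r s
    (B : 'M[{mpoly K[n]}]_(s, r)) :
  is_submodule (kernel B).
Proof.
split=> [|x y|a x]; rewrite /kernel ?mul0mx // ?mulmxDl.
  by move=> -> ->; rewrite addr0.
by move=> xB; rewrite -scalemxAl xB scaler0.
Qed.

Fixpoint iterated_weight n e (rk : nat -> nat)
    (lm : forall i, 'I_(rk i) -> mmon n (shifted_rank e rk i)) (i : nat) :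
    mmon n (shifted_rank e rk i) -> mmon n e :=
  match i with
  | 0 => id
  | i'.+1 => pullback_weight (iterated_weight lm (i := i')) (@lm i')
  end.

Lemma initial_form_homogeneous (K : fieldType) n e (A : zmodType)
    (deg : 'X_{1..n} -> A) r s (bdeg : 'I_r -> A) (cdeg : 'I_s -> A)
    (wt : mmon n r -> mmon n e) lm
    (B : 'M[{mpoly K[n]}]_(s, r)) :
  homogeneous_matrix deg bdeg cdeg B ->
  homogeneous_matrix deg bdeg cdeg (initial_form wt lm B).
Proof.
move=> hB k; apply/homogeneousP => u; rewrite vcoef_initial_form.
have /homogeneousP hBk := hB k.
by case: ifP => [_|]; [apply: hBk | rewrite eqxx].
Qed.

Lemma initial_form_constant_part (K : fieldType) n e r s
    (wt : mmon n r -> mmon n e) lm (B : 'M[{mpoly K[n]}]_(s, r)) :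
  constant_part B = 0 -> constant_part (initial_form wt lm B) = 0.
Proof.
move=> B0; apply/matrixP=> k l; rewrite !mxE.
have := vcoef_initial_form wt lm B k (0%MM, l); rewrite /vcoef /= !mxE => ->.
by have /matrixP/(_ k l) := B0; rewrite !mxE => ->; rewrite if_same.
Qed.

Theorem theorem3p11
  (K : fieldType) (n : nat) (A : zmodType) (deg : 'X_{1..n} -> A)
  (deg_add : monomial_grading deg) (deg_nice : nice_grading K deg)
  (e : nat) (edeg : 'I_e -> A)
  (M : 'rV[{mpoly K[n]}]_e -> Prop) (M_graded : graded_submodule deg edeg M)
  (lt : rel 'X_{1..n}) (lt_ordering : monomial_ordering lt)
  (lt0 : rel (mmon n e)) (lt0_ordering : module_ordering lt lt0)
  (G : seq 'rV[{mpoly K[n]}]_e)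
  (G_homogeneous : forall g, g \in G -> exists j, homogeneous deg edeg j g)
  (G_groebner : groebner_basis lt0 M G)
  (F : free_sequence K n A e) (F_output : schreyer_output deg edeg lt0 G F)
  (F_minimal : minimal_graded_free_resolution deg edeg M F) :
  forall (i : nat) (j : A),
    graded_betti deg edeg M i j
    = graded_betti deg edeg (initial_submodule lt0 M) i j.
Proof.
move=> i j; rewrite (graded_betti_minimal deg_add _ _ F_minimal).
case: F_output => -[_ rowsG] homF [prec prec_total steps].
pose ord i := @schreyer_ordering _ _ _ _ lt0 F prec i.
(* The submodule of F_(i-1) of which the rows of [bmap F i] form a Gröbner basis, uniformly in
   [i]. *)
pose N i : 'rV[{mpoly K[n]}]_(shifted_rank e (rk F) i) -> Prop :=
  match i with 0 => M | i'.+1 => kernel (bmap F i') end.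
have N_groebner k : groebner_basis (ord k) (N k) (rows (bmap F k)).
  case: k => [|k]; last by have [a []] := steps k.
  have [GM G_monic G_init] := G_groebner; split=> [g|g|v]; rewrite ?rowsG;
    [exact: GM | exact: G_monic |].
  rewrite G_init; split=> -[l [lP ->]]; exists l;
    split=> // t /lP [_ [g [u [gG LMg ->]]]].
    by split=> //; exists g, u; rewrite rowsG.
  by split=> //; exists g, u; rewrite -rowsG.
have N_sub k : is_submodule (N k).
  case: k => [|k]; first by case: M_graded.
  exact: kernel_is_submodule.
have LM_row k (u : 'I_(rk F k)) : {m | LM (ord k) (row u (bmap F k)) = Some m}.
  case E: (LM _ _) => [m|]; first by exists m.
  exfalso; have [_ /(_ _ (row_in_rows (bmap F k) u)) [m]] := N_groebner k.
  by rewrite E.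
pose lm k (u : 'I_(rk F k)) := sval (LM_row k u).
have lmP k u : LM (ord k) (row u (bmap F k)) = Some (lm k u).
  exact: svalP (LM_row k u).
have ord_ordering k : module_ordering lt (ord k).
  elim: k => [|k IHk]; first exact: lt0_ordering.
  by have := pullback_module_ordering lt_ordering IHk (lmP k) (prec_total k).
pose wt k := @iterated_weight n e (rk F) lm k.
have wtP k : weight_function lt0 (ord k) (wt k).
  elim: k => [|k IHk]; first by split=> // u w; right.
  by have := pullback_weight_function (ord_ordering k) (lmP k) (prec k) IHk.
(* Ranks and degrees are those of [F], so the two counts of basis elements coincide by
   conversion. *)
pose F0 : free_sequence K n A e :=
  FreeSequence (@bdeg _ _ _ _ F)
    (fun k => initial_form (wt k) (lm k) (bmap F k)).
have F0_minimal :
    minimal_graded_free_resolution deg edeg (initial_submodule lt0 M) F0.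
  have [_ F_min] := F_minimal; split; last first.
    move=> k; apply/max_ideal_mulmxP/initial_form_constant_part.
    exact/max_ideal_mulmxP/F_min.
  split.
  - by move=> k; apply: initial_form_homogeneous; apply: homF.
  (* At index 0 the weight is the identity, so only the leading monomial survives, with coefficient
     1; the Gröbner property then makes these rows generate the initial submodule. *)
  - have row_F0 u : row u (bmap F0 0) = mmon_vec K (lm 0%N u).
      apply: vcoef_inj => w; rewrite vcoef_initial_form.
      rewrite /mmon_vec -['X_[_]]scale1r vcoef_term -surjective_pairing /wt /=.
      by case: eqP => [->|//]; rewrite (vcoef_lm (lmP 0%N) (N_groebner 0%N)).
    have [_ _ init] := N_groebner 0%N.
    move=> v; split=> [/(init v).1 [l [lP ->]]|[w ->]].
      rewrite big_seq; elim/big_ind: _ =>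
        [|x y [x' ->] [y' ->]|t /lP [_ [g [m [/mapP[u _ ->] LMg tE]]]]].
      + by exists 0; rewrite mul0mx.
      + by exists (x' + y'); rewrite mulmxDl.
      + exists (t.1 *: delta_mx 0 u); rewrite -scalemxAl -rowE row_F0 tE.
        by move: LMg; rewrite lmP => -[->].
    rewrite mulmx_sum_row; apply/(init _).2.
    exists [seq (w 0 u, row u (bmap F0 0)) | u <- enum 'I_(rk F 0)]; split.
      move=> _ /mapP[u _ ->]; split=> //; rewrite row_F0.
      by exists (row u (bmap F 0)), (lm 0%N u); rewrite row_in_rows.
    by rewrite big_map big_enum.
  - move=> k v; by have := initial_form_exact lt_ordering lt0_ordering
      (ord_ordering k) (lmP k) (prec_total k) (wtP k) (N_sub k) (N_groebner k)
      (lmP k.+1) (N_groebner k.+1) v.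
by rewrite (graded_betti_minimal deg_add _ _ F0_minimal).
Qed.
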